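(* Let $\mathfrak X,\mathfrak Y$ be Polish spaces, and let $\mu,\nu$ be probability measures on $\mathfrak X,\mathfrak Y$ respectively. Suppose that there exist continuous functions $c_X\in L^1(\mu)$ and $c_Y\in L^1(\nu)$ such that the cost function $c:(\mathfrak X\times\mathfrak Y)^2\to\mathbb R$ is jointly continuous and satisfies pointwise $$|c(x,y,x',y')|\le c_X(x)+c_Y(y)+c_X(x')+c_Y(y').$$ Consider the following statements: (i) every $\pi\in\Pi(\mu,\nu)$ is a minimizer of $\pi\mapsto\iint c\,\mathrm d\pi\otimes\mathrm d\pi$ over $\Pi(\mu,\nu)$; (ii) $\pi_{\rm ind}=\mu\otimes\nu$ is a minimizer or a maximizer of $\pi\mapsto\iint c\,\mathrm d\pi\otimes\mathrm d\pi$ over $\Pi(\mu,\nu)$; (iii) there exist functions $\varphi:\mathfrak X\to\mathbb R$ and $\psi:\mathfrak Y\to\mathbb R$ such that $$\tilde c(x,y):=\frac12\iint\big(c(x,y,x',y')+c(x',y',x,y)\big)\,\mathrm d\mu(x')\,\mathrm d\nu(y')=\varphi(x)+\psi(y)\quad\text{for }\pi_{\rm ind}\text{-a.e. }(x,y).$$ Then (i) $\Rightarrow$ (ii) $\Rightarrow$ (iii). Moreover, if in addition $c(x,y,x',y')=\phi((x,y),(x',y'))$ for some bounded, continuous, positive definite kernel $\phi$ on $\mathfrak X\times\mathfrak Y$, then (iii) implies that $\pi_{\rm ind}$ is a minimizer of $\pi\mapsto\iint c\,\mathrm d\pi\otimes\mathrm d\pi$ over $\Pi(\mu,\nu)$,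 and hence (ii) and (iii) are equivalent.
   Context: $\Pi(\mu,\nu)$ is the set of all probability measures on $\mathfrak X\times\mathfrak Y$ with marginals $\mu$ and $\nu$, and $\iint c\,\mathrm d\pi\otimes\mathrm d\pi=\iint c(x,y,x',y')\,\mathrm d\pi(x,y)\,\mathrm d\pi(x',y')$. For a non-empty set $S$, a symmetric kernel $\phi:S\times S\to\mathbb R$ is positive definite if $\sum_{i=1}^n\sum_{j=1}^n c_ic_j\phi(s_i,s_j)\ge 0$ for all $n\in\mathbb N$, $s_1,\dots,s_n\in S$, $c_1,\dots,c_n\in\mathbb R$. *)

(* Defs.v *)
From HB Require Import structures.
From mathcomp Require Import all_boot all_order all_algebra.
From mathcomp Require Import all_classical all_reals all_analysis.

Set Implicit Arguments.
Unset Strict Implicit.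
Unset Printing Implicit Defensive.

Import Order.TTheory GRing.Theory Num.Theory.
Import numFieldNormedType.Exports.

Local Open Scope classical_set_scope.
Local Open Scope ring_scope.

(* Complete metrizability is expressed up to homeomorphism, so that it is a
   property of the topology of [T] and no metric is singled out. *)
Definition polish (R : realType) (T : topologicalType) : Prop :=
  exists (M : metricType R) (f : T -> M) (g : M -> T),
    [/\ cancel f g /\ cancel g f,
        continuous f /\ continuous g,
        forall F : set_system M, ProperFilter F -> cauchy F -> exists x : M, F --> x
      & exists2 D : set M, countable D & dense D].

(* The library's generated sigma-algebras need a point; a space carrying a
   probability measure is nonempty anyway. *)
Definition borel (T : ptopologicalType) : measurableType (@open T).-sigma :=
  Measurable.clone _ (g_sigma_algebraType (@open T)) _.

Lemma metric_ball_open (R : realType) (M : metricType R) (x : M) (e : R) :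
  open (ball x e).
Proof.
rewrite openE => y /=; rewrite ballEmdist /= => xy.
apply/nbhs_ballP; exists (e - mdist x y); first by rewrite /= subr_gt0.
move=> z; rewrite !ballEmdist /= => yz.
by rewrite (le_lt_trans (metric_triangle _ y _))// -ltrBrDl.
Qed.

Lemma polish_second_countable (R : realType) (T : topologicalType) :
  polish R T -> @second_countable T.
Proof.
move=> [M [f [g [[fK gK] [cf cg] _ [D cD dD]]]]].
pose b (p : M * nat) : set T := f @^-1` (ball p.1 (p.2.+1%:R^-1 : R)).
have ob p : open (b p).
  by move/continuousP: cf; apply; exact: metric_ball_open.
exists (b @` (D `*` setT)).
  apply: (@sub_countable _ _ _ (D `*` [set: nat])); first exact: card_image_le.
  exact: countableX.
split=> [_ [p _ <-]//|x U Ux].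
have : nbhs (f x) (g @^-1` U) by apply: cg; rewrite fK.
move/nbhs_ballP => -[e /= e0 eU].
have [n ne] : exists n : nat, n.+1%:R^-1 < e / 2.
  exists (Num.truncn (e / 2)^-1); rewrite invf_plt ?posrE ?divr_gt0//.
  by rewrite truncnS_gt.
have n0 : (0 : R) < n.+1%:R^-1 by rewrite invr_gt0.
have [|d [Od Dd]] := dD _ _ (metric_ball_open (f x) (n.+1%:R^-1)).
  by exists (f x); exact: ballxx.
exists (b (d, n)); first by split; [exists (d, n)|exact: ball_sym].
move=> y /= dy; rewrite -[y]fK; apply: eU.
apply: (@le_ball _ _ _ (n.+1%:R^-1 + n.+1%:R^-1)).
  by rewrite [e]splitr lerD ?ltW.
exact: ball_triangle Od dy.
Qed.

Lemma borel_prodE (R : realType) (X Y : ptopologicalType) :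
  polish R X -> polish R Y ->
  (@measurable _ (borel X * borel Y)%type) = <<s @open (X * Y)%type >>.
Proof.
move=> /polish_second_countable[BX cBX [oBX bBX]].
move=> /polish_second_countable[BY cBY [oBY bBY]].
pose S : measurableType _ := g_sigma_algebraType (@open (X * Y)%type).
have mfst : measurable_fun [set: S] (fst : S -> borel X).
  apply: (@measurability _ _ S (borel X) _ _ (@open X) erefl).
  move=> _ [A oA <-]; rewrite setTI; apply: sub_sigma_algebra.
  have /continuousP : continuous (@fst X Y) by move=> z; exact: cvg_fst.
  exact.
have msnd : measurable_fun [set: S] (snd : S -> borel Y).
  apply: (@measurability _ _ S (borel Y) _ _ (@open Y) erefl).
  move=> _ [A oA <-]; rewrite setTI; apply: sub_sigma_algebra.
  have /continuousP : continuous (@snd X Y) by move=> z; exact: cvg_snd.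
  exact.
apply/seteqP; split.
  rewrite measurable_prod_measurableType.
  apply: smallest_sub; first exact: smallest_sigma_algebra.
  move=> _ [A mA [B mB <-]].
  have := measurableI _ _ (mfst measurableT _ mA) (msnd measurableT _ mB).
  by rewrite !setTI.
apply: smallest_sub; first exact: sigma_algebra_measurable.
move=> W oW.
pose P := [set UV | [/\ BX UV.1, BY UV.2 & UV.1 `*` UV.2 `<=` W]].
have -> : W = \bigcup_(UV in P) (UV.1 `*` UV.2).
  apply/seteqP; split=> [[x y] Wxy|z [UV [_ _]]]; last exact.
  move: oW; rewrite openE => /(_ _ Wxy) [[A B] [/= Ax By] ABW].
  have [U [BU Ux] UA] := bBX _ _ Ax.
  have [V [BV Vy] VB] := bBY _ _ By.
  exists (U, V) => //; split=> // z [Uz Vz]; apply: ABW.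
  by split; [exact: UA|exact: VB].
have mP UV : P UV ->
    @measurable _ (borel X * borel Y)%type (UV.1 `*` UV.2).
  move=> [BU BV _]; apply: measurableX.
  - by apply: sub_sigma_algebra; exact: oBX.
  - by apply: sub_sigma_algebra; exact: oBY.
have /pfcard_geP[->|[h]] : countable P.
- apply: (@sub_countable _ _ _ (BX `*` BY)); last exact: countableX.
  by apply: subset_card_le => UV [].
- by rewrite bigcup_set0; exact: measurable0.
have hP i : P (h i) by exact: funS.
rewrite (@reindex_bigcup _ _ _ h setT P _ (fun i _ => hP i) (@surj _ _ _ _ h)).
by apply: bigcupT_measurable => i; apply: mP.
Qed.

Section couplings.
Context (R : realType) (X Y : ptopologicalType).

(* The joint laws live on the product of the two Borel sigma-algebras, which
   is the carrier of the library's product measure; for Polish [X] and [Y] it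
   is the Borel sigma-algebra of the product topology ([borel_prodE]). *)
Definition coupling (mu : probability (borel X) R) (nu : probability (borel Y) R) :
    set (probability (borel X * borel Y)%type R) :=
  [set pi | (forall A : set (borel X), measurable A ->
               pushforward pi fst A = mu A) /\
            (forall B : set (borel Y), measurable B ->
               pushforward pi snd B = nu B)].

Definition indep (mu : probability (borel X) R) (nu : probability (borel Y) R) :
    probability (borel X * borel Y)%type R := (mu \x nu)%E.

Definition qcost (c : (X * Y) * (X * Y) -> R)
    (pi : probability (borel X * borel Y)%type R) : \bar R :=
  (\int[pi \x pi]_z (c z)%:E)%E.

(* Extended-real valued, so that no default value of the integral is hidden. *)
Definition ctilde (c : (X * Y) * (X * Y) -> R)
    (mu : probability (borel X) R) (nu : probability (borel Y) R)
    (p : X * Y) : \bar R :=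
  ((2^-1)%:E * \int[mu \x nu]_q (c (p, q) + c (q, p))%:E)%E.

End couplings.

Definition minimizer (R : realType) (T : Type) (A : set T) (F : T -> \bar R)
  (a : T) : Prop := A a /\ forall b, A b -> (F a <= F b)%E.

Definition maximizer (R : realType) (T : Type) (A : set T) (F : T -> \bar R)
  (a : T) : Prop := A a /\ forall b, A b -> (F b <= F a)%E.

Definition pos_def_kernel (R : realType) (S : Type) (phi : S -> S -> R) : Prop :=
  (forall s t, phi s t = phi t s) /\
  (forall (n : nat) (s : 'I_n -> S) (a : 'I_n -> R),
     0 <= \sum_(i < n) \sum_(j < n) a i * a j * phi (s i) (s j)).

(* Main.v *)
Require Import Defs.
From HB Require Import structures.
From mathcomp Require Import all_boot all_order all_algebra.
From mathcomp Require Import all_classical all_reals all_analysis.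
From mathcomp Require Import measurable_realfun ring lra.

Import Order.TTheory GRing.Theory Num.Theory.
Import numFieldNormedType.Exports.

Local Open Scope classical_set_scope.
Local Open Scope ring_scope.

Set Implicit Arguments.
Unset Strict Implicit.
Unset Printing Implicit Defensive.

(** Write m for the product measure and w for the symmetrized potential
    c~(p) = 1/2 int (c(p, q) + c(q, p)) dm(q).  The dominating function
    b = cX + cY is integrable against every coupling, with the same integral,
    so the cost is always finite and equals int int c dpi dpi.

    That (i) implies (ii) is immediate, since m is a coupling.

    (ii) implies (iii): if h is measurable, |h| <= 1, and both marginals of
    h m vanish, then (1 + s h) m is a coupling for every |s| <= 1, and its cost
    is cost(m) + 2 s int h w dm + O(s^2) ([cost_perturbation]).  As s may have
    either sign, an extremum at m forces int h w dm = 0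
    ([extremal_product_annihilator]).  Let r = w - phi - psi be what remains
    of w after removing its two conditional means.  Projecting sg(r) on the
    functions with vanishing marginals gives an admissible h, up to a factor
    1/4, and this projection is self-adjoint and fixes r; hence
    0 = int h w dm = 1/4 int |r| dm, that is, w = phi + psi almost everywhere
    ([ae_split_of_annihilator]).

    (iii) implies minimality for a positive definite kernel k: with
    sigma = pi - m, cost(pi) - cost(m) = int int k dsigma dsigma
    + 2 int w dsigma.  The first term is nonnegative
    ([energy_distance_ge0]).  The second one vanishes, but pi may be
    singular with respect to m, so the m-almost-everywhere identity (iii) must
    be transferred to pi.  Positive definiteness makes w continuous
    ([pd_potential_continuous]).  For suitable x0, y0 the continuous function
    w(x, y) - w(x, y0) - w(x0, y) + w(x0, y0) vanishes m-almost everywhere;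
    the open set where it does not vanish is a countable union of open
    rectangles U x V, each with mu(U) nu(V) = 0, and a coupling gives such a
    rectangle at most min(mu(U), nu(V)) = 0 ([coupling_null_open]).  Thus
    int w dpi depends on the marginals of pi only. *)

(** * Real integrals against a probability *)

Local Notation L1 P f := (P.-integrable setT (EFin \o f)).

Section L1_theory.
Context d (T : measurableType d) (R : realType) (P : probability T R).
Implicit Types f g h : T -> R.

Lemma L1_measurable f : L1 P f -> measurable_fun setT f.
Proof. by move=> /measurable_int /measurable_EFinP. Qed.

Lemma L1_dominated f g : measurable_fun setT f ->
  (forall x, `|f x| <= g x) -> L1 P g -> L1 P f.
Proof.
move=> mf fg; apply: le_integrable => //; first exact/measurable_EFinP.
by move=> x _ /=; rewrite lee_fin (le_trans (fg x))// ler_norm.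
Qed.

Lemma L1_bounded f (C : R) : measurable_fun setT f ->
  (forall x, `|f x| <= C) -> L1 P f.
Proof.
move=> mf fC; apply: (L1_dominated (g := cst C)) => //.
exact: finite_measure_integrable_cst.
Qed.

Lemma L1_cst (C : R) : L1 P (cst C).
Proof. exact: finite_measure_integrable_cst. Qed.

Lemma L1D f g : L1 P f -> L1 P g -> L1 P (fun x => f x + g x).
Proof.
move=> Pf Pg.
rewrite (_ : EFin \o _ = ((EFin \o f) \+ (EFin \o g))%E); last exact/funext.
exact: integrableD.
Qed.

Lemma L1Zl a f : L1 P f -> L1 P (fun x => a * f x).
Proof.
move=> Pf; rewrite (_ : EFin \o _ = (fun x => a%:E * (EFin \o f) x)%E)//.
exact: integrableZl.
Qed.

Lemma L1N f : L1 P f -> L1 P (fun x => - f x).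
Proof.
by move=> /(L1Zl (-1)); apply: eq_integrable => // x _ /=; rewrite mulN1r.
Qed.

Lemma L1B f g : L1 P f -> L1 P g -> L1 P (fun x => f x - g x).
Proof. by move=> Pf Pg; apply: L1D => //; exact: L1N. Qed.

Lemma L1M f g (C : R) : L1 P f -> measurable_fun setT g ->
  (forall x, `|g x| <= C) -> L1 P (fun x => g x * f x).
Proof.
move=> Pf mg gC; apply: (L1_dominated (g := fun x => C * `|f x|)).
- by apply: measurable_funM => //; exact: L1_measurable Pf.
- by move=> x; rewrite normrM ler_wpM2r.
- by apply: L1Zl; exact: integrable_norm Pf.
Qed.

Lemma RintegralE f : L1 P f ->
  (\int[P]_x (f x)%:E)%E = (\int[P]_x f x)%:E.
Proof.
by move=> Pf; rewrite /Rintegral fineK//; exact: integrable_fin_num Pf.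
Qed.

Lemma Rint_cst (C : R) : \int[P]_x C = C.
Proof. by rewrite Rintegral_cst//= probability_setT mulr1. Qed.

Lemma RintD f g : L1 P f -> L1 P g ->
  \int[P]_x (f x + g x) = \int[P]_x f x + \int[P]_x g x.
Proof. exact: RintegralD. Qed.

Lemma RintB f g : L1 P f -> L1 P g ->
  \int[P]_x (f x - g x) = \int[P]_x f x - \int[P]_x g x.
Proof. exact: RintegralB. Qed.

Lemma RintZ a f : L1 P f -> \int[P]_x (a * f x) = a * \int[P]_x f x.
Proof. exact: RintegralZl. Qed.

Lemma Rint_bound f (C : R) : L1 P f -> (forall x, `|f x| <= C) ->
  `|\int[P]_x f x| <= C.
Proof.
move=> Pf fC; apply: (le_trans (le_normr_Rintegral _ _)) => //.
rewrite -[leRHS](Rint_cst C); apply: le_Rintegral => //.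
- exact: integrable_norm Pf.
- exact: L1_cst.
Qed.

Lemma Rint_ae_eq f g : L1 P f -> measurable_fun setT g ->
  {ae P, forall x, f x = g x} -> \int[P]_x f x = \int[P]_x g x.
Proof.
move=> Pf mg fg; congr fine; apply: ae_eq_integral => //.
- exact: measurable_int Pf.
- exact/measurable_EFinP.
- by apply: filterS fg => x /= ->.
Qed.

Lemma Rint_norm_eq0 f : L1 P f -> \int[P]_x `|f x| = 0 ->
  {ae P, forall x, f x = 0}.
Proof.
move=> Pf f0.
have : (\int[P]_x `|(EFin \o f) x|)%E = 0%E.
  have /= := RintegralE (integrable_norm Pf).
  by rewrite f0.
move/(ae_eq_integral_abs _ measurableT (measurable_int _ Pf)).
by apply: filterS => x /(_ I) /= [].
Qed.

End L1_theory.

(** The law of [F] under [P] is given as a hypothesis rather than as the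
    measure [pushforward P F], so that the marginals of a coupling, known only
    through their values on measurable sets, fit directly. *)
Section image_measure.
Context d d' (T : measurableType d) (U : measurableType d') (R : realType).
Variables (P : probability T R) (Q : probability U R) (F : T -> U).
Hypothesis mF : measurable_fun setT F.
Let mF_mixin := isMeasurableFun.Build _ _ _ _ F mF.
Let mF_pack : {mfun T >-> U} := HB.pack F mF_mixin.
Hypothesis PQ : forall A, measurable A -> pushforward P F A = Q A.

Lemma L1_image (f : U -> R) : L1 Q f -> L1 P (f \o F).
Proof.
move=> Qf; have mf := L1_measurable Qf.
apply/integrableP; split; first exact/measurable_EFinP/measurableT_comp.
move/integrableP : Qf => [_]; apply: le_lt_trans.
rewrite (eq_measure_integral (pushforward P mF_pack)); last first.
  by move=> A mA _; exact/esym/PQ.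
rewrite ge0_integral_pushforward//.
by apply: measurableT_comp => //; exact/measurable_EFinP.
Qed.

Lemma Rint_image (f : U -> R) : L1 Q f -> \int[P]_x f (F x) = \int[Q]_y f y.
Proof.
move=> Qf; have PfF := L1_image Qf.
rewrite /Rintegral [in RHS](eq_measure_integral (pushforward P mF_pack));
  last first.
  by move=> A mA _; exact/esym/PQ.
rewrite integral_pushforward//.
exact: measurable_int Qf.
Qed.

Lemma ae_image (p : U -> Prop) :
  {ae Q, forall y, p y} -> {ae P, forall x, p (F x)}.
Proof.
move=> [N [mN N0 pN]]; exists (F @^-1` N); split.
- by rewrite -[_ @^-1` _]setTI; exact: mF.
- by rewrite -N0; exact: PQ.
- by move=> x /= ?; apply: pN.
Qed.

End image_measure.
Arguments L1_bounded {d T R P f} C _ _.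
Arguments L1_cst {d T R P} C.
Arguments Rint_cst {d T R P} C.

(** * Product probabilities *)

Section product_marginals.
Context d1 d2 (T1 : measurableType d1) (T2 : measurableType d2) (R : realType).
Variables (P : probability T1 R) (Q : probability T2 R).

Lemma product_marginal1 A : measurable A -> pushforward (P \x Q)%E fst A = P A.
Proof.
move=> mA; rewrite /pushforward (_ : fst @^-1` A = A `*` setT).
  by rewrite product_measure1E// [X in (_ * X)%E](probability_setT Q) mule1.
by apply/seteqP; split => [[x y]|[x y] []].
Qed.

Lemma product_marginal2 A : measurable A -> pushforward (P \x Q)%E snd A = Q A.
Proof.
move=> mA; rewrite /pushforward (_ : snd @^-1` A = setT `*` A).
  by rewrite product_measure1E// [X in (X * _)%E](probability_setT P) mul1e.
by apply/seteqP; split => [[x y]|[x y] []].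
Qed.

Lemma L1_fst f : L1 P f -> L1 (P \x Q)%E (fun z => f z.1).
Proof.
exact: (L1_image (P := (P \x Q)%E) measurable_fst product_marginal1).
Qed.

Lemma L1_snd f : L1 Q f -> L1 (P \x Q)%E (fun z => f z.2).
Proof.
exact: (L1_image (P := (P \x Q)%E) measurable_snd product_marginal2).
Qed.

Lemma Rint_fst f : L1 P f -> \int[(P \x Q)%E]_z f z.1 = \int[P]_x f x.
Proof.
exact: (Rint_image (P := (P \x Q)%E) measurable_fst product_marginal1).
Qed.

Lemma Rint_snd f : L1 Q f -> \int[(P \x Q)%E]_z f z.2 = \int[Q]_x f x.
Proof.
exact: (Rint_image (P := (P \x Q)%E) measurable_snd product_marginal2).
Qed.

Section fubini.
Variable f : T1 * T2 -> R.
Hypothesis Pf : L1 (P \x Q)%E f.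

Section fubini1.
Hypothesis Qf : forall x, L1 Q (fun y => f (x, y)).

Lemma L1_fubini1 : L1 P (fun x => \int[Q]_y f (x, y)).
Proof.
apply: eq_integrable (integrable_fubini_F Pf) => // x _.
by rewrite /fubini_F [LHS](RintegralE (Qf x)).
Qed.

Lemma Rint_fubini1 : \int[(P \x Q)%E]_z f z = \int[P]_x \int[Q]_y f (x, y).
Proof.
congr fine; rewrite -(integral12_prod_meas1 Pf); apply: eq_integral => x _.
by rewrite /fubini_F [LHS](RintegralE (Qf x)).
Qed.
End fubini1.

Section fubini2.
Hypothesis Qf : forall y, L1 P (fun x => f (x, y)).

Lemma L1_fubini2 : L1 Q (fun y => \int[P]_x f (x, y)).
Proof.
have mf := measurable_int _ Pf.
apply/integrableP; split.
  apply: eq_measurable_fun (measurable_fubini_G Pf) => // y _.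
  by rewrite /fubini_G [LHS](RintegralE (Qf y)).
have := (integrable21ltyP _ _ mf).1 Pf; apply: le_lt_trans.
apply: ge0_le_integral => //.
- apply: measurableT_comp => //.
  apply: eq_measurable_fun (measurable_fubini_G Pf) => // y _.
  by rewrite /fubini_G [LHS](RintegralE (Qf y)).
- apply: (measurable_fun_fubini_tonelli_G (abse \o EFin \o f)) => //=.
  by apply: (measurableT_comp (f := abse) _ mf).
- move=> y _; rewrite (_ : (EFin \o _) y = (\int[P]_x (f (x, y))%:E)%E);
    last by rewrite [RHS](RintegralE (Qf y)).
  by apply: le_abse_integral => //; exact: measurable_int (Qf y).
Qed.

Lemma Rint_fubini2 : \int[(P \x Q)%E]_z f z = \int[Q]_y \int[P]_x f (x, y).
Proof.
congr fine; rewrite -(integral21_prod_meas1 Pf); apply: eq_integral => x _.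
by rewrite /fubini_G [LHS](RintegralE (Qf x)).
Qed.
End fubini2.

End fubini.

(** By Fubini, fibre by fibre: on a fibre the factor [G] is constant. *)
Lemma Rint_zero_marginal1 (h : T1 * T2 -> R) (G : T1 -> R) :
  (forall x, L1 Q (fun y => h (x, y))) -> (forall x, \int[Q]_y h (x, y) = 0) ->
  L1 (P \x Q)%E (fun z => G z.1 * h z) -> \int[(P \x Q)%E]_z (G z.1 * h z) = 0.
Proof.
move=> Qh h0 PGh; rewrite Rint_fubini1//; last first.
  by move=> x; exact: (L1Zl (G x) (Qh x)).
under eq_Rintegral do rewrite /= RintZ// h0 mulr0.
by rewrite Rint_cst.
Qed.

Lemma Rint_zero_marginal2 (h : T1 * T2 -> R) (G : T2 -> R) :
  (forall y, L1 P (fun x => h (x, y))) -> (forall y, \int[P]_x h (x, y) = 0) ->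
  L1 (P \x Q)%E (fun z => G z.2 * h z) -> \int[(P \x Q)%E]_z (G z.2 * h z) = 0.
Proof.
move=> Qh h0 PGh; rewrite Rint_fubini2//; last first.
  by move=> y; exact: (L1Zl (G y) (Qh y)).
under eq_Rintegral do rewrite /= RintZ// h0 mulr0.
by rewrite Rint_cst.
Qed.

Lemma ae_exists (p : T1 -> Prop) : {ae P, forall x, p x} -> exists x, p x.
Proof.
move=> [N [mN N0 pN]]; apply: contrapT => /forallNP np.
have : P setT = 0%E.
  by rewrite -N0; congr (P _); apply/seteqP; split => // x _; exact/pN/np.
by move/eqP; rewrite probability_setT onee_eq0.
Qed.

Let indic_bound (A : set (T1 * T2)) z : `|\1_A z| <= 1 :> R.
Proof. by rewrite indicE; case: (_ \in _); rewrite ?normr0 ?normr1. Qed.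

(** The indicator of a null set containing the exceptions has zero integral,
    so by Fubini almost all of its section integrals are zero. *)
Lemma ae_section (p : T1 * T2 -> Prop) : {ae (P \x Q)%E, forall z, p z} ->
  {ae P, forall x, {ae Q, forall y, p (x, y)}} /\
  {ae Q, forall y, {ae P, forall x, p (x, y)}}.
Proof.
move=> [N [mN N0 pN]].
pose f : T1 * T2 -> R := \1_N.
have mf : measurable_fun setT f by exact: measurable_indic.
have If : L1 (P \x Q)%E f by apply: (L1_bounded 1) => // z; exact: indic_bound.
have f0 : \int[(P \x Q)%E]_z f z = 0.
  by rewrite /Rintegral integral_indic// setIT; exact: (congr1 fine N0).
have f_ge0 z : 0 <= f z by rewrite /f indicE.
have Qf x : L1 Q (fun y => f (x, y)).
  apply: (L1_bounded 1) => [|y]; last exact: indic_bound.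
  by apply: (measurableT_comp mf); exact: pair1_measurable.
have Pf y : L1 P (fun x => f (x, y)).
  apply: (L1_bounded 1) => [|x]; last exact: indic_bound.
  by apply: (measurableT_comp mf); exact: pair2_measurable.
have fp z : f z = 0 -> p z.
  rewrite /f indicE => fz; apply: contrapT => npz.
  by move: fz; rewrite mem_set; [move=> /eqP; rewrite oner_eq0|exact: pN].
split.
- have : {ae P, forall x, \int[Q]_y f (x, y) = 0}.
    apply: Rint_norm_eq0; first exact: L1_fubini1.
    rewrite -f0 Rint_fubini1//; apply: eq_Rintegral => x _.
    by rewrite ger0_norm// Rintegral_ge0.
  apply: filterS => x fx0.
  have : {ae Q, forall y, f (x, y) = 0}.
    apply: Rint_norm_eq0 => //; rewrite -fx0; apply: eq_Rintegral => y _.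
    by rewrite ger0_norm.
  by apply: filterS => y; exact: fp.
- have : {ae Q, forall y, \int[P]_x f (x, y) = 0}.
    apply: Rint_norm_eq0; first exact: L1_fubini2.
    rewrite -f0 Rint_fubini2//; apply: eq_Rintegral => x _.
    by rewrite ger0_norm// Rintegral_ge0.
  apply: filterS => y fy0.
  have : {ae P, forall x, f (x, y) = 0}.
    apply: Rint_norm_eq0 => //; rewrite -fy0; apply: eq_Rintegral => x _.
    by rewrite ger0_norm.
  by apply: filterS => x; exact: fp.
Qed.

End product_marginals.

(** * Double integrals of positive definite kernels *)

Section bounded_kernel.
Context d1 d2 (T1 : measurableType d1) (T2 : measurableType d2) (R : realType).
Variables (P : probability T1 R) (Q : probability T2 R).
Variables (k : T1 * T2 -> R) (C : R).
Hypotheses (mk : measurable_fun setT k) (kC : forall z, `|k z| <= C).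

Lemma L1_bounded_kernel : L1 (P \x Q)%E k.
Proof. exact: (L1_bounded C). Qed.

Lemma L1_bounded_kernelr x : L1 Q (fun y => k (x, y)).
Proof.
apply: (L1_bounded C) => //.
by apply: (measurableT_comp mk); exact: pair1_measurable.
Qed.

Lemma L1_bounded_kernell y : L1 P (fun x => k (x, y)).
Proof.
apply: (L1_bounded C) => //.
by apply: (measurableT_comp mk); exact: pair2_measurable.
Qed.

Lemma L1_bounded_potential : L1 P (fun x => \int[Q]_y k (x, y)).
Proof. exact: L1_fubini1 L1_bounded_kernel L1_bounded_kernelr. Qed.

End bounded_kernel.

Section integral_of_psd_kernel.
Context d (T : measurableType d) (R : realType) (P : probability T R).
Variables (k : T * T -> R) (C : R).
Hypotheses (mk : measurable_fun setT k) (kC : forall z, `|k z| <= C).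
Hypothesis k_sym : forall x y, k (x, y) = k (y, x).
Hypothesis k_psd : forall l : seq T, 0 <= \sum_(x <- l) \sum_(y <- l) k (x, y).

Let E := \int[P]_x \int[P]_y k (x, y).
Let D := \int[P]_x k (x, x).
Let gram (l : seq T) := \sum_(x <- l) \sum_(y <- l) k (x, y).
Let field (l : seq T) (y : T) := \sum_(x <- l) k (x, y).

Let L1_field l : L1 P (field l).
Proof.
elim: l => [|x l IH].
  by rewrite /field; under eq_fun do rewrite big_nil; exact: L1_cst.
rewrite /field; under eq_fun do rewrite big_cons.
by apply: L1D => //; exact: (L1_bounded_kernelr P mk kC).
Qed.

Let L1_diag : L1 P (fun x => k (x, x)).
Proof.
apply: (L1_bounded C) => //.
by apply: (measurableT_comp mk); exact: measurable_fun_pair.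
Qed.

Let gram_cons x l : gram (x :: l) = k (x, x) + 2 * field l x + gram l.
Proof.
rewrite /gram big_cons big_cons.
under [X in _ + X = _]eq_bigr do rewrite big_cons.
rewrite big_split/= /field.
rewrite -[X in _ + (X + _) = _]/(field l x) (eq_bigr (fun y => k (y, x))) //.
rewrite -/(field l x); ring.
Qed.

(** Expectation of a Gram sum at random points.  Adjoin to the points of [l]
    a further [n] independent points of law [P]: the right-hand side is the
    expectation of the Gram sum of the enlarged family.  The induction
    integrates out one random point at a time, which avoids the [n]-fold product
    of [P]. *)
Lemma psd_sampling n l :
  0 <= gram l + 2 * n%:R * \int[P]_y field l y
       + n%:R * (n%:R - 1) * E + n%:R * D.
Proof.
elim: n l => [|n IH] l; first by rewrite mulr0 !mul0r !addr0; exact: k_psd.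
pose U := \int[P]_y field l y.
have fieldE x : \int[P]_y field (x :: l) y = \int[P]_y k (x, y) + U.
  rewrite -RintD//; last exact: (L1_bounded_kernelr P mk kC).
  by apply: eq_Rintegral => y _; rewrite /field big_cons.
have L1p := L1_bounded_potential P P mk kC.
pose K0 := gram l + 2 * n%:R * U + n%:R * (n%:R - 1) * E + n%:R * D.
have IHx x : 0 <= k (x, x) + 2 * field l x + 2 * n%:R * \int[P]_y k (x, y) + K0.
  have := IH (x :: l); rewrite gram_cons fieldE.
  by congr (_ <= _); rewrite /K0; ring.
have := Rintegral_ge0 P (D := setT) (fun x _ => IHx x).
rewrite RintD ?Rint_cst; [|do ?apply: L1D => //; exact: L1Zl|exact: L1_cst].
rewrite RintD; [|apply: L1D => //; exact: L1Zl|exact: L1Zl].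
rewrite RintD; [|by []|exact: L1Zl].
rewrite !RintZ// -/D -/E -/U; congr (_ <= _); rewrite /K0 -natr1; ring.
Qed.

(** The off-diagonal terms of the Gram sum of [n] independent points
    contribute [n (n - 1) E] and the diagonal only [n D], so a negative [E]
    would make the expectation negative for large [n]. *)
Lemma Rint_psd_kernel : 0 <= \int[P]_x \int[P]_y k (x, y).
Proof.
rewrite -/E leNgt; apply/negP => E0.
(* [n] is chosen so that [(n - 1) * - E > `|D|]. *)
pose n := (Num.truncn (`|D| / - E)).+2.
have nD : `|D| / - E < n%:R - 1.
  by rewrite /n -natr1 addrK truncnS_gt.
have n0 : 0 < n%:R :> R by rewrite ltr0n.
have := psd_sampling n [::].
rewrite /gram /field big_nil add0r.
under eq_Rintegral do rewrite big_nil.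
rewrite Rint_cst mulr0 add0r -mulrA -mulrDr pmulr_rge0//.
apply/negP; rewrite -ltNge.
move: nD; rewrite ltr_pdivrMr ?oppr_gt0// => nD.
have := ler_norm D; lra.
Qed.

End integral_of_psd_kernel.

Lemma pos_def_kernel_seq (R : realType) (S : Type) (k : S -> S -> R) :
  pos_def_kernel k -> forall l : seq (R * S),
  0 <= \sum_(p <- l) \sum_(q <- l) p.1 * q.1 * k p.2 q.2.
Proof.
move=> [_ kp] l.
rewrite big_tnth; under eq_bigr do rewrite big_tnth.
exact: (kp _ (fun i => (tnth (in_tuple l) i).2)
             (fun i => (tnth (in_tuple l) i).1)).
Qed.

(** For [(x, x')] drawn from the product of [P] and [Q], the double integral of
    the kernel [K] below is the double integral of [k] against [P - Q]; as [K]
    is again positive definite, the signed measure needs no separate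
    argument. *)
Section energy_distance.
Context d (T : measurableType d) (R : realType) (P Q : probability T R).
Variables (k : T -> T -> R) (C : R).
Hypothesis mk : measurable_fun setT (fun z : T * T => k z.1 z.2).
Hypothesis kC : forall x y, `|k x y| <= C.
Hypothesis kpd : pos_def_kernel k.

Let K (z : (T * T) * (T * T)) :=
  k z.1.1 z.2.1 - k z.1.1 z.2.2 - k z.1.2 z.2.1 + k z.1.2 z.2.2.

Let mk2 (f g : (T * T) * (T * T) -> T) : measurable_fun setT f ->
  measurable_fun setT g -> measurable_fun setT (fun z => k (f z) (g z)).
Proof.
move=> mf mg.
exact: (measurableT_comp (f := fun z : T * T => k z.1 z.2) mk
          (measurable_fun_pair mf mg)).
Qed.

Let mK : measurable_fun setT K.
Proof.
have m11 : measurable_fun setT (fun z : (T * T) * (T * T) => z.1.1).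
  exact: (measurableT_comp measurable_fst measurable_fst).
have m12 : measurable_fun setT (fun z : (T * T) * (T * T) => z.1.2).
  exact: (measurableT_comp measurable_snd measurable_fst).
have m21 : measurable_fun setT (fun z : (T * T) * (T * T) => z.2.1).
  exact: (measurableT_comp measurable_fst measurable_snd).
have m22 : measurable_fun setT (fun z : (T * T) * (T * T) => z.2.2).
  exact: (measurableT_comp measurable_snd measurable_snd).
apply: measurable_funD; last exact: mk2.
apply: measurable_funB; last exact: mk2.
by apply: measurable_funB; exact: mk2.
Qed.

Let KC z : `|K z| <= C + C + C + C.
Proof.
rewrite /K (le_trans (ler_normD _ _))// lerD//.
rewrite (le_trans (ler_normB _ _))// lerD//.
by rewrite (le_trans (ler_normB _ _))// lerD.
Qed.

Let Ksym x y : K (x, y) = K (y, x).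
Proof.
rewrite /K/= (kpd.1 x.1 y.1) (kpd.1 x.1 y.2) (kpd.1 x.2 y.1) (kpd.1 x.2 y.2).
ring.
Qed.

Let Kpsd (l : seq (T * T)) : 0 <= \sum_(x <- l) \sum_(y <- l) K (x, y).
Proof.
(* The Gram sum of [K] over pairs is that of [k] over their entries, weighted
   by [1] for a first entry and [-1] for a second one. *)
have := pos_def_kernel_seq kpd
  ([seq (1, z.1) | z <- l] ++ [seq (-1, z.2) | z <- l]).
rewrite big_cat/= !big_map -big_split/=; congr (_ <= _).
apply: eq_bigr => x _; rewrite !big_cat/= !big_map -!big_split/=.
by apply: eq_bigr => y _; rewrite /K/=; ring.
Qed.

Lemma energy_distance_ge0 :
  0 <= \int[P]_x \int[P]_y k x y - \int[P]_x \int[Q]_y k x y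
       - (\int[Q]_x \int[P]_y k x y - \int[Q]_x \int[Q]_y k x y).
Proof.
have kC' (z : T * T) : `|(fun z : T * T => k z.1 z.2) z| <= C by exact: kC.
have kr (M : probability T R) x : L1 M (fun y => k x y).
  exact: (L1_bounded_kernelr M mk kC').
have pot (M N : probability T R) : L1 M (fun x => \int[N]_y k x y).
  exact: (L1_bounded_potential M N mk kC').
have := Rint_psd_kernel (P \x Q)%E mK KC Ksym Kpsd.
congr (_ <= _).
transitivity (\int[(P \x Q)%E]_x
    ((\int[P]_y k x.1 y - \int[Q]_y k x.1 y) -
     (\int[P]_y k x.2 y - \int[Q]_y k x.2 y))).
  apply: eq_Rintegral => x _; rewrite /K/=.
  rewrite RintD; [|do ?apply: L1B|]; last 4 first.
  - exact: (L1_fst Q (kr P x.1)).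
  - exact: (L1_snd P (kr Q x.1)).
  - exact: (L1_fst Q (kr P x.2)).
  - exact: (L1_snd P (kr Q x.2)).
  rewrite RintB; [|do ?apply: L1B|]; last 3 first.
  - exact: (L1_fst Q (kr P x.1)).
  - exact: (L1_snd P (kr Q x.1)).
  - exact: (L1_fst Q (kr P x.2)).
  rewrite RintB; last 2 first.
  - exact: (L1_fst Q (kr P x.1)).
  - exact: (L1_snd P (kr Q x.1)).
  rewrite (Rint_fst Q (kr P x.1)) (Rint_snd P (kr Q x.1)).
  by rewrite (Rint_fst Q (kr P x.2)) (Rint_snd P (kr Q x.2)); ring.
rewrite RintB; last 2 first.
- exact: (L1_fst Q (L1B (pot P P) (pot P Q))).
- exact: (L1_snd P (L1B (pot Q P) (pot Q Q))).
rewrite (Rint_fst Q (L1B (pot P P) (pot P Q))).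
rewrite (Rint_snd P (L1B (pot Q P) (pot Q Q))).
by rewrite !RintB.
Qed.

End energy_distance.

(** * Second-order expansion of a quadratic functional *)

Section density.
Context d (T : measurableType d) (R : realType) (P : probability T R).
Variable f : T -> R.
Hypotheses (f_ge0 : forall x, 0 <= f x) (Pf : L1 P f) (Pf1 : \int[P]_x f x = 1).

Definition density_measure (A : set T) : \bar R :=
  (\int[P]_(x in A) (f x)%:E)%E.

Let density0 : density_measure set0 = 0%E.
Proof. by rewrite /density_measure integral_set0. Qed.

Let density_ge0 A : (0 <= density_measure A)%E.
Proof. by apply: integral_ge0 => x _; rewrite lee_fin. Qed.

Let density_sigma_additive : semi_sigma_additive density_measure.
Proof.
move=> F mF tF mUF; rewrite /density_measure.
rewrite ge0_integral_bigcup//=; last 2 first.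
  exact/measurable_funTS/measurable_int/Pf.
  by move=> x _; rewrite lee_fin.
apply: is_cvg_ereal_nneg_natsum_cond => n _ _.
by apply: integral_ge0 => x _; rewrite lee_fin.
Qed.

HB.instance Definition _ := isMeasure.Build _ _ _ density_measure
  density0 density_ge0 density_sigma_additive.

Let density_setT : density_measure [set: _] = 1%E.
Proof. by rewrite /density_measure RintegralE// Pf1. Qed.

HB.instance Definition _ :=
  @Measure_isProbability.Build _ _ R density_measure density_setT.

Lemma probability_of_density : exists D : probability T R,
  forall A, measurable A -> D A = (\int[P]_(x in A) (f x)%:E)%E.
Proof. by exists (density_measure : probability T R). Qed.

End density.

(** The Radon-Nikodym derivative of [D] is [f] almost everywhere, as both have
    the same integral over every measurable set. *)
Lemma Rint_density d (T : measurableType d) (R : realType)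
    (P D : probability T R) (f g : T -> R) : L1 P f ->
  (forall A, measurable A -> D A = (\int[P]_(x in A) (f x)%:E)%E) ->
  L1 D g -> \int[D]_x g x = \int[P]_x (f x * g x).
Proof.
move=> Pf Df Dg.
have DP : D `<< P.
  apply/null_content_dominatesP => A mA PA0; rewrite Df//.
  by apply: null_set_integral => //; exact/measurable_funTS/(measurable_int _ Pf).
have mg := measurable_int _ Dg.
have mRN : measurable_fun setT (Radon_Nikodym (charge_of_finite_measure D) P).
  have DPc : charge_of_finite_measure D `<< P by exact: DP.
  exact: (measurable_int _ (Radon_Nikodym_integrable DPc)).
rewrite /Rintegral -(Radon_Nikodym_change_of_variables DP)//; congr fine.
have ae_density :
    ae_eq P setT (Radon_Nikodym (charge_of_finite_measure D) P) (EFin \o f).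
  apply: integral_ae_eq => //; first exact: Radon_Nikodym_integrable.
    exact: measurable_int Pf.
  by move=> A _ mA; rewrite -Radon_Nikodym_integral//= -Df.
apply: ae_eq_integral => //.
- exact: emeasurable_funM.
- apply/measurable_EFinP/measurable_funM; apply: L1_measurable.
  + exact: Pf.
  + exact: Dg.
- by apply: filterS ae_density => x /= /[apply] ->; rewrite EFinM muleC.
Qed.

Section dominated_kernel.
Context d (T : measurableType d) (R : realType) (P Q : probability T R).
Variables (b : T -> R) (c : T * T -> R).
Hypothesis mc : measurable_fun setT c.
Hypothesis cb : forall p q, `|c (p, q)| <= b p + b q.
Hypotheses (Pb : L1 P b) (Qb : L1 Q b).

Lemma L1_dominated_kernel : L1 (P \x Q)%E c.
Proof.
apply: (L1_dominated (g := fun z => b z.1 + b z.2)) => //; first by case.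
by apply: L1D; [exact: L1_fst|exact: L1_snd].
Qed.

Lemma L1_dominated_kernelr p : L1 Q (fun q => c (p, q)).
Proof.
apply: (L1_dominated (g := fun q => b p + b q)) => //.
  by apply: (measurableT_comp mc); exact: pair1_measurable.
by apply: L1D => //; exact: L1_cst.
Qed.

Lemma L1_dominated_kernell q : L1 P (fun p => c (p, q)).
Proof.
apply: (L1_dominated (g := fun p => b p + b q)) => //.
  by apply: (measurableT_comp mc); exact: pair2_measurable.
by apply: L1D => //; exact: L1_cst.
Qed.

Lemma L1_dominated_potentialr : L1 P (fun p => \int[Q]_q c (p, q)).
Proof. exact: L1_fubini1 L1_dominated_kernel L1_dominated_kernelr. Qed.

Lemma L1_dominated_potentiall : L1 Q (fun q => \int[P]_p c (p, q)).
Proof. exact: L1_fubini2 L1_dominated_kernel L1_dominated_kernell. Qed.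

End dominated_kernel.

Section perturbation.
Context d (T : measurableType d) (R : realType) (P : probability T R).
Variables (b : T -> R) (c : T * T -> R).
Hypothesis mc : measurable_fun setT c.
Hypothesis cb : forall p q, `|c (p, q)| <= b p + b q.
Hypothesis Pb : L1 P b.
Variables (h : T -> R).
Hypotheses (mh : measurable_fun setT h) (h1 : forall p, `|h p| <= 1).

Let cr := L1_dominated_kernelr mc cb Pb.
Let cl := L1_dominated_kernell mc cb Pb.
Let U p := \int[P]_q c (p, q).
Let U' q := \int[P]_p c (p, q).
Let V p := \int[P]_q (h q * c (p, q)).

(** Expansion of the quadratic functional along the density [1 + s h]: the two
    first-order terms, one for each argument of [c], are brought to the same
    variable by Fubini. *)
Lemma cost_perturbation (s : R) (D : probability T R) : L1 D b ->
  (forall A, measurable A -> D A = (\int[P]_(x in A) (1 + s * h x)%:E)%E) ->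
  \int[D]_p \int[D]_q c (p, q) = \int[P]_p U p +
    s * \int[P]_p (h p * (U p + U' p)) + s ^+ 2 * \int[P]_p (h p * V p).
Proof.
move=> Db Ddens.
have Ph : L1 P h by apply: (L1_bounded 1).
have Pdens : L1 P (fun x => 1 + s * h x).
  by apply: L1D; [exact: L1_cst|exact: L1Zl].
have hM f : L1 P f -> L1 P (fun x => h x * f x).
  by move=> Pf; exact: (L1M Pf mh h1).
have dens f : L1 D f -> L1 P f ->
    \int[D]_x f x = \int[P]_x f x + s * \int[P]_x (h x * f x).
  move=> Df Pf; rewrite (Rint_density Pdens Ddens Df).
  under eq_Rintegral do rewrite mulrDl mul1r -mulrA.
  by rewrite RintD// ?RintZ//; [exact: hM|apply: L1Zl; exact: hM].
have hc : L1 (P \x P)%E (fun z => h z.2 * c z).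
  apply: (L1M (C := 1) (L1_dominated_kernel mc cb Pb Pb)) => //.
  exact: measurableT_comp mh measurable_snd.
have PU : L1 P U by exact: L1_dominated_potentialr mc cb Pb Pb.
have PU' : L1 P U' by exact: L1_dominated_potentiall mc cb Pb Pb.
have PV : L1 P V.
  by apply: (L1_fubini1 hc) => p /=; exact: hM.
have inner p : \int[D]_q c (p, q) = U p + s * V p.
  by rewrite dens; [|exact: (L1_dominated_kernelr mc cb Db)|exact: cr].
have PUV : L1 P (fun p => U p + s * V p) by apply: L1D => //; exact: L1Zl.
under eq_Rintegral do rewrite inner.
rewrite dens//; last first.
  have := L1_dominated_potentialr mc cb Db Db.
  by apply: eq_integrable => // p _; rewrite /= inner.
(* Perturbing the second argument only and then exchanging the integrals. *)
have VU' : \int[P]_p V p = \int[P]_p (h p * U' p).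
  rewrite /V -(Rint_fubini1 hc) ?(Rint_fubini2 hc)//=; last first.
  - by move=> p; exact: hM.
  - by move=> q; exact: L1Zl.
  by apply: eq_Rintegral => q _; rewrite RintZ.
rewrite RintD ?RintZ ?VU'//; last exact: L1Zl.
have -> : \int[P]_p (h p * (U p + U' p)) =
    \int[P]_p (h p * U p) + \int[P]_p (h p * U' p).
  rewrite -RintD; [|exact: hM|exact: hM].
  by apply: eq_Rintegral => p _; rewrite mulrDr.
have -> : \int[P]_p (h p * (U p + s * V p)) =
    \int[P]_p (h p * U p) + s * \int[P]_p (h p * V p).
  rewrite -RintZ -?RintD; [|exact: hM|apply: L1Zl; exact: hM|exact: hM].
  by apply: eq_Rintegral => p _; rewrite mulrDr mulrCA.
move: (\int[P]_p U p) (\int[P]_p (h p * U p)) (\int[P]_p (h p * U' p))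
  (\int[P]_p (h p * V p)) => u a a' v.
ring.
Qed.

End perturbation.

(** For small [s] of sign opposite to [a] the quadratic term cannot compensate
    the linear one. *)
Lemma linear_coef_eq0 (R : realFieldType) (a k : R) :
  (forall s, `|s| <= 1 -> 0 <= s * a + s ^+ 2 * k) -> a = 0.
Proof.
move=> H; apply/eqP; rewrite -normr_le0 leNgt; apply/negP => a0.
(* This [t] is at most [1] and satisfies [t * `|k| < `|a|]. *)
pose t := `|a| / (`|a| + `|k|).
have den0 : 0 < `|a| + `|k| by rewrite ltr_pwDl.
have t0 : 0 < t by rewrite divr_gt0.
have t1 : t <= 1 by rewrite /t ler_pdivrMr// mul1r lerDl.
have tk : t * `|k| < `|a|.
  rewrite /t mulrAC ltr_pdivrMr// ltr_pM2l// ltrDr//.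
have an0 : a != 0 by rewrite -normr_gt0.
have := H (- Num.sg a * t).
rewrite normrM normrN normr_sg an0 mul1r gtr0_norm// => /(_ t1).
have -> : - Num.sg a * t * a = - (t * `|a|) by rewrite [in RHS]normrEsg; ring.
rewrite exprMn sqrrN sqr_sg an0 mul1r.
rewrite (_ : _ + _ = t * (t * k - `|a|)); last by ring.
rewrite pmulr_rge0//.
have := ler_norm (t * k); rewrite normrM (gtr0_norm t0); lra.
Qed.

(** * First-order conditions at a product measure *)

Lemma measurable_sgr d (T : measurableType d) (R : realType) (f : T -> R) :
  measurable_fun setT f -> measurable_fun setT (fun x => Num.sg (f x)).
Proof.
move=> mf; rewrite /Num.sg.
apply: measurable_fun_ifT => //; first exact: measurable_fun_eqr.
by apply: measurable_fun_ifT => //; exact: measurable_fun_ltr.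
Qed.

Section zero_marginals.
Context d1 d2 (T1 : measurableType d1) (T2 : measurableType d2) (R : realType).
Variables (mu : probability T1 R) (nu : probability T2 R).

Definition zero_marginals (h : T1 * T2 -> R) : Prop :=
  (forall x, \int[nu]_y h (x, y) = 0) /\ (forall y, \int[mu]_x h (x, y) = 0).

Section annihilator.
Variable w : T1 * T2 -> R.
Hypotheses (Iw : L1 (mu \x nu)%E w).
Hypotheses (wr : forall x, L1 nu (fun y => w (x, y))).
Hypotheses (wl : forall y, L1 mu (fun x => w (x, y))).

Let phi x := \int[nu]_y w (x, y).
Let psi y := \int[mu]_x w (x, y) - \int[(mu \x nu)%E]_z w z.
Let r z := w z - phi z.1 - psi z.2.

Let Iphi : L1 mu phi. Proof. exact: L1_fubini1 Iw wr. Qed.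
Let Ipsi : L1 nu psi.
Proof. by apply: L1B; [exact: L1_fubini2 Iw wl|exact: L1_cst]. Qed.

Let Iphi_fst : L1 (mu \x nu)%E (fun z => phi z.1). Proof. exact: L1_fst. Qed.
Let Ipsi_snd : L1 (mu \x nu)%E (fun z => psi z.2). Proof. exact: L1_snd. Qed.
Let Ir : L1 (mu \x nu)%E r. Proof. by apply: L1B => //; exact: L1B. Qed.

Let rr x : L1 nu (fun y => r (x, y)).
Proof.
by apply: L1B => //; apply: L1B; [exact: wr|exact: (L1_cst (phi x))].
Qed.

Let rl y : L1 mu (fun x => r (x, y)).
Proof.
apply: L1B; last exact: (L1_cst (psi y)).
by apply: L1B; [exact: wl|exact: Iphi].
Qed.

Let r0 : zero_marginals r.
Proof.
split=> [x|y].
- rewrite RintB//=; last by apply: L1B; [exact: wr|exact: L1_cst].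
  rewrite RintB//; [|exact: L1_cst].
  rewrite Rint_cst RintB; [|exact: L1_fubini2 Iw wl|exact: L1_cst].
  by rewrite Rint_cst (Rint_fubini2 Iw wl) /phi; ring.
- rewrite RintB/=; [|by apply: L1B; [exact: wl|exact: Iphi]|exact: L1_cst].
  rewrite Rint_cst RintB//= /psi (Rint_fubini1 Iw wr).
  by rewrite /phi; ring.
Qed.

Let mulC1 (f g : T1 * T2 -> R) : L1 (mu \x nu)%E (fun z => f z * g z) ->
  L1 (mu \x nu)%E (fun z => g z * f z).
Proof. by apply: eq_integrable => // z _ /=; rewrite mulrC. Qed.

(** The functions [phi] and [psi] are the conditional means of [w], the second
    one centred so that the remainder [r] has vanishing marginals.  Testing [w]
    against the projection of the sign of [r] on the functions with vanishing
    marginals yields the L1 norm of [r]. *)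
Lemma ae_split_of_annihilator :
  (forall h : T1 * T2 -> R, measurable_fun setT h -> (forall z, `|h z| <= 1) ->
     zero_marginals h -> \int[(mu \x nu)%E]_z (h z * w z) = 0) ->
  exists (f : T1 -> R) (g : T2 -> R),
    {ae (mu \x nu)%E, forall z, w z = f z.1 + g z.2}.
Proof.
move=> w_ann; exists phi, psi.
suff : {ae (mu \x nu)%E, forall z, r z = 0}.
  by apply: filterS => z /eqP; rewrite /r -addrA -opprD subr_eq0 => /eqP.
apply: Rint_norm_eq0 => //.
pose g z := Num.sg (r z).
have mg : measurable_fun setT g.
  by apply: measurable_sgr; exact: L1_measurable Ir.
have g1 z : `|g z| <= 1.
  by rewrite /g normr_sg; case: (_ != _); rewrite //= ler01.
have Ig : L1 (mu \x nu)%E g by apply: (L1_bounded 1).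
have gr := L1_bounded_kernelr nu mg g1.
have gl := L1_bounded_kernell mu mg g1.
pose g_1 x := \int[nu]_y g (x, y).
pose g_2 y := \int[mu]_x g (x, y).
pose g_0 := \int[(mu \x nu)%E]_z g z.
have Ig_1 : L1 mu g_1 by exact: L1_fubini1 Ig gr.
have Ig_2 : L1 nu g_2 by exact: L1_fubini2 Ig gl.
have g_11 x : `|g_1 x| <= 1 by exact: Rint_bound.
have g_21 y : `|g_2 y| <= 1 by exact: Rint_bound.
have g_01 : `|g_0| <= 1 by exact: Rint_bound.
(* Projection of [g] on the functions with vanishing marginals; each of its
   four terms is bounded by [1], whence the normalization. *)
pose h z := 4^-1 * (g z - g_1 z.1 - g_2 z.2 + g_0).
have mg_1 : measurable_fun setT (fun z : T1 * T2 => g_1 z.1).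
  exact: measurableT_comp (L1_measurable Ig_1) measurable_fst.
have mg_2 : measurable_fun setT (fun z : T1 * T2 => g_2 z.2).
  exact: measurableT_comp (L1_measurable Ig_2) measurable_snd.
have mh : measurable_fun setT h.
  apply: measurable_funM => //; apply: measurable_funD => //.
  by apply: measurable_funB => //; apply: measurable_funB.
have h1 z : `|h z| <= 1.
  rewrite normrM ger0_norm ?invr_ge0// -ler_pdivlMl ?invr_gt0// invrK mulr1.
  rewrite (_ : 4 = 1 + 1 + 1 + 1); last by ring.
  rewrite (le_trans (ler_normD _ _))// lerD//.
  rewrite (le_trans (ler_normB _ _))// lerD//.
  by rewrite (le_trans (ler_normB _ _))// lerD.
have Ih : L1 (mu \x nu)%E h by exact: (L1_bounded 1).
have hr := L1_bounded_kernelr nu mh h1.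
have hl := L1_bounded_kernell mu mh h1.
have h0 : zero_marginals h.
  split=> [x|y].
  - have A1 : L1 nu (fun y => g (x, y) - g_1 x).
      exact: (L1B (gr x) (L1_cst (g_1 x))).
    have A2 : L1 nu (fun y => g (x, y) - g_1 x - g_2 y) := L1B A1 Ig_2.
    have A3 : L1 nu (fun y => g (x, y) - g_1 x - g_2 y + g_0).
      exact: (L1D A2 (L1_cst g_0)).
    rewrite /h/= (RintZ _ A3) (RintD A2 (L1_cst g_0)) (RintB A1 Ig_2).
    rewrite (RintB (gr x) (L1_cst (g_1 x))) !Rint_cst.
    by rewrite /g_0 (Rint_fubini2 Ig gl) -/(g_1 x) /g_2; ring.
  - have A1 : L1 mu (fun x => g (x, y) - g_1 x) := L1B (gl y) Ig_1.
    have A2 : L1 mu (fun x => g (x, y) - g_1 x - g_2 y).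
      exact: (L1B A1 (L1_cst (g_2 y))).
    have A3 : L1 mu (fun x => g (x, y) - g_1 x - g_2 y + g_0).
      exact: (L1D A2 (L1_cst g_0)).
    rewrite /h/= (RintZ _ A3) (RintD A2 (L1_cst g_0)).
    rewrite (RintB A1 (L1_cst (g_2 y))) (RintB (gl y) Ig_1) !Rint_cst.
    by rewrite /g_0 (Rint_fubini1 Ig gr) -/(g_2 y) /g_1; ring.
have hw0 := w_ann _ mh h1 h0.
have Ihr : L1 (mu \x nu)%E (fun z => h z * r z) by exact: (L1M Ir mh h1).
have Iphih : L1 (mu \x nu)%E (fun z => phi z.1 * h z).
  by apply: mulC1; exact: (L1M Iphi_fst mh h1).
have Ipsih : L1 (mu \x nu)%E (fun z => psi z.2 * h z).
  by apply: mulC1; exact: (L1M Ipsi_snd mh h1).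
(* [w] and [r] differ by [phi + psi], which is orthogonal to [h]. *)
have hr0 : \int[(mu \x nu)%E]_z (h z * r z) = 0.
  rewrite -hw0 -[LHS]addr0.
  rewrite -[X in _ + X = _](Rint_zero_marginal1 hr h0.1 Iphih) -RintD//.
  rewrite -[LHS]addr0.
  rewrite -[X in _ + X = _](Rint_zero_marginal2 hl h0.2 Ipsih) -RintD//.
    by apply: eq_Rintegral => z _; rewrite /r; ring.
  exact: L1D.
have Ig_1r : L1 (mu \x nu)%E (fun z => g_1 z.1 * r z) by exact: (L1M Ir mg_1).
have Ig_2r : L1 (mu \x nu)%E (fun z => g_2 z.2 * r z) by exact: (L1M Ir mg_2).
have Igr : L1 (mu \x nu)%E (fun z => g z * r z) by exact: (L1M Ir mg).
have Ig0r : L1 (mu \x nu)%E (fun z => g_0 * r z) by exact: L1Zl.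
(* Conversely the correction terms of [h] are orthogonal to [r]. *)
have e1 := Rint_zero_marginal1 rr r0.1 Ig_1r.
have e2 := Rint_zero_marginal2 rl r0.2 Ig_2r.
have e0 := Rint_zero_marginal1 (G := cst g_0) rr r0.1 Ig0r.
have -> : \int[(mu \x nu)%E]_z `|r z| = \int[(mu \x nu)%E]_z (g z * r z).
  by apply: eq_Rintegral => z _; rewrite normrEsg.
have : 4 * \int[(mu \x nu)%E]_z (h z * r z) = 0 by rewrite hr0 mulr0.
rewrite -RintZ//.
rewrite (eq_Rintegral _ (g := fun z =>
    g z * r z - g_1 z.1 * r z - g_2 z.2 * r z + g_0 * r z)); last first.
  by move=> z _; rewrite /h; field.
rewrite RintD//; last by apply: L1B => //; exact: L1B.
rewrite RintB//; last exact: L1B.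
by rewrite RintB// e1 e2 [X in _ + X = _]e0 !subr0 addr0.
Qed.

End annihilator.
End zero_marginals.

Section extremal_product.
Context d1 d2 (T1 : measurableType d1) (T2 : measurableType d2) (R : realType).
Variables (mu : probability T1 R) (nu : probability T2 R).

Definition has_marginals (D : probability (T1 * T2)%type R) : Prop :=
  (forall A, measurable A -> pushforward D fst A = mu A) /\
  (forall B, measurable B -> pushforward D snd B = nu B).

Section density.
Variables (h : T1 * T2 -> R).
Hypotheses (mh : measurable_fun setT h) (h1 : forall z, `|h z| <= 1).
Hypothesis h0 : zero_marginals mu nu h.

Let Ih : L1 (mu \x nu)%E h. Proof. exact: (L1_bounded 1). Qed.

Let Rint_h : \int[(mu \x nu)%E]_z h z = 0.
Proof.
have := Rint_zero_marginal1 (G := cst 1) (L1_bounded_kernelr nu mh h1) h0.1 (L1Zl 1 Ih).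
by under eq_Rintegral do rewrite mul1r.
Qed.

Let Rint_h_fst A : measurable A ->
  \int[(mu \x nu)%E]_(z in fst @^-1` A) h z = 0.
Proof.
move=> mA; rewrite Rintegral_mkcond.
rewrite (eq_Rintegral _ (g := fun z => (\1_A z.1 : R) * h z)); last first.
  move=> z _; rewrite patchE indicE; have [zA|zA] := pselect (A z.1).
    by rewrite !mem_set// mul1r.
  by rewrite !memNset// mul0r.
apply: (Rint_zero_marginal1 (G := \1_A) (L1_bounded_kernelr nu mh h1) h0.1).
apply: (L1M (C := 1) Ih); last first.
  by move=> z; rewrite indicE; case: (_ \in _); rewrite ?normr0 ?normr1.
have mi : measurable_fun setT (\1_A : T1 -> R) by exact: measurable_indic.
exact: (measurableT_comp mi measurable_fst).
Qed.

Let Rint_h_snd A : measurable A ->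
  \int[(mu \x nu)%E]_(z in snd @^-1` A) h z = 0.
Proof.
move=> mA; rewrite Rintegral_mkcond.
rewrite (eq_Rintegral _ (g := fun z => (\1_A z.2 : R) * h z)); last first.
  move=> z _; rewrite patchE indicE; have [zA|zA] := pselect (A z.2).
    by rewrite !mem_set// mul1r.
  by rewrite !memNset// mul0r.
apply: (Rint_zero_marginal2 (G := \1_A) (L1_bounded_kernell mu mh h1) h0.2).
apply: (L1M (C := 1) Ih); last first.
  by move=> z; rewrite indicE; case: (_ \in _); rewrite ?normr0 ?normr1.
have mi : measurable_fun setT (\1_A : T2 -> R) by exact: measurable_indic.
exact: (measurableT_comp mi measurable_snd).
Qed.

(** The perturbation leaves the mass of every cylinder over a marginal set
    unchanged because [h] integrates to zero on it. *)
Lemma perturbed_product (s : R) : `|s| <= 1 ->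
  exists2 D : probability (T1 * T2)%type R, has_marginals D &
    forall A, measurable A ->
      D A = (\int[(mu \x nu)%E]_(z in A) (1 + s * h z)%:E)%E.
Proof.
move=> s1.
have Idens : L1 (mu \x nu)%E (fun z => 1 + s * h z).
  by apply: L1D; [exact: L1_cst|exact: L1Zl].
have [z|//||D DE] :=
  @probability_of_density _ _ _ (mu \x nu)%E (fun z => 1 + s * h z).
- have : `|s * h z| <= 1 by rewrite normrM mulr_ile1.
  by rewrite ler_norml => /andP[]; lra.
- rewrite RintD ?RintZ ?Rint_h ?Rint_cst ?mulr0 ?addr0//.
    exact: L1_cst.
  exact: L1Zl.
have key A : measurable A -> \int[(mu \x nu)%E]_(z in A) h z = 0 ->
    D A = (mu \x nu)%E A.
  move=> mA hA0; rewrite DE//.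
  have IhA : (mu \x nu)%E.-integrable A (EFin \o h) by exact: integrableS Ih.
  rewrite integralD_EFin//=; last 2 first.
  - exact: (integrableS measurableT mA (@subsetT _ A) (L1_cst 1)).
  - exact: (integrableS measurableT mA (@subsetT _ A) (L1Zl s Ih)).
  rewrite integral_cst// mul1e -[RHS]adde0; congr (_ + _)%E.
  under eq_integral do rewrite EFinM.
  rewrite integralZl//; move: hA0; rewrite /Rintegral.
  have := integrable_fin_num mA IhA.
  by case: (integral _ _ _) => //= r _ ->; rewrite -EFinM mulr0.
exists D => //; split=> A mA.
- rewrite -(product_marginal1 mu nu mA) /pushforward key//; last exact: Rint_h_fst.
  by rewrite -[X in measurable X]setTI; exact: measurable_fst.
- rewrite -(product_marginal2 mu nu mA) /pushforward key//; last exact: Rint_h_snd.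
  by rewrite -[X in measurable X]setTI; exact: measurable_snd.
Qed.

End density.

Variables (b1 : T1 -> R) (b2 : T2 -> R) (c : (T1 * T2) * (T1 * T2) -> R).
Hypotheses (Ib1 : L1 mu b1) (Ib2 : L1 nu b2) (mc : measurable_fun setT c).
Hypothesis cb : forall p q, `|c (p, q)| <= (b1 p.1 + b2 p.2) + (b1 q.1 + b2 q.2).

Lemma L1_marginals D : has_marginals D -> L1 D (fun z => b1 z.1 + b2 z.2).
Proof.
move=> [D1 D2]; apply: L1D.
- exact: (L1_image measurable_fst D1 Ib1).
- exact: (L1_image measurable_snd D2 Ib2).
Qed.

Let cost (D : probability (T1 * T2)%type R) := \int[D]_p \int[D]_q c (p, q).

Lemma product_has_marginals : has_marginals (mu \x nu)%E.
Proof. by split=> A mA; [exact: product_marginal1|exact: product_marginal2]. Qed.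

(** The sign of [e] distinguishes minimality ([e > 0]) from maximality
    ([e < 0]). *)
Lemma extremal_product_annihilator (e : R) : e != 0 ->
  (forall D, has_marginals D -> e * cost (mu \x nu)%E <= e * cost D) ->
  forall h : T1 * T2 -> R, measurable_fun setT h -> (forall z, `|h z| <= 1) ->
    zero_marginals mu nu h ->
    \int[(mu \x nu)%E]_p (h p * (\int[(mu \x nu)%E]_q c (p, q) +
                                \int[(mu \x nu)%E]_q c (q, p))) = 0.
Proof.
move=> e0 extremal h mh h1 h0.
set L := (X in X = 0).
pose K := \int[(mu \x nu)%E]_p (h p * \int[(mu \x nu)%E]_q (h q * c (p, q))).
suff : e * L = 0 by move/eqP; rewrite mulf_eq0 (negbTE e0)/= => /eqP.
apply: (linear_coef_eq0 (k := e * K)) => s s1.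
have [D Dm DE] := perturbed_product mh h1 h0 s1.
have := extremal D Dm.
rewrite /cost (cost_perturbation mc cb (L1_marginals product_has_marginals)
  mh h1 (L1_marginals Dm) DE).
by rewrite -/L -/K !mulrDr -addrA lerDl; congr (_ <= _); ring.
Qed.

End extremal_product.

(** * Open sets of a product, null sets, positive definite potentials *)

Section rectangles.
Variables S1 S2 : topologicalType.
Hypotheses (sc1 : @second_countable S1) (sc2 : @second_countable S2).

(** An open subset of the product is the union of the countably many
    rectangles of basic open sets that it contains. *)
Lemma open_bigcup_rectangles (W : set (S1 * S2)) : open W ->
  exists A B, [/\ forall i : nat, open (A i), forall i, open (B i) &
    W = \bigcup_i (A i `*` B i)].
Proof.
move: sc1 sc2 => [B1 cB1 [oB1 bB1]] [B2 cB2 [oB2 bB2]] oW.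
pose P := [set UV | [/\ B1 UV.1, B2 UV.2 & UV.1 `*` UV.2 `<=` W]].
have WE : W = \bigcup_(UV in P) (UV.1 `*` UV.2).
  apply/seteqP; split=> [[x y] Wxy|z [UV [_ _]]]; last exact.
  move: oW; rewrite openE => /(_ _ Wxy) [[A B] [/= Ax By] ABW].
  have [U [BU Ux] UA] := bB1 _ _ Ax.
  have [V [BV Vy] VB] := bB2 _ _ By.
  exists (U, V) => //; split=> // z [Uz Vz]; apply: ABW.
  by split; [exact: UA|exact: VB].
have /pfcard_geP[P0|[h]] : countable P.
- apply: (@sub_countable _ _ _ (B1 `*` B2)); last exact: countableX.
  by apply: subset_card_le => UV [].
- exists (fun=> set0), (fun=> set0); split => [_|_|]; [exact: open0|exact: open0|].
  by rewrite WE P0 bigcup_set0 bigcup0// => i _; rewrite set0X.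
have hP i : P (h i) by exact: funS.
exists (fun i => (h i).1), (fun i => (h i).2); split => [i|i|].
- by apply: oB1; have [] := hP i.
- by apply: oB2; have [] := hP i.
- rewrite {1}WE.
  by rewrite (@reindex_bigcup _ _ _ h setT P _ (fun i _ => hP i) (@surj _ _ _ _ h)).
Qed.

Lemma second_countable_prod : @second_countable (S1 * S2)%type.
Proof.
move: sc1 sc2 => [B1 cB1 [oB1 bB1]] [B2 cB2 [oB2 bB2]].
exists ((fun UV => UV.1 `*` UV.2) @` (B1 `*` B2)).
  apply: (@sub_countable _ _ _ (B1 `*` B2)); first exact: card_image_le.
  exact: countableX.
split=> [_ [UV [BU BV] <-]|[x y] W [[A B] [/= Ax By] ABW]].
  rewrite openE => -[a b] [/= Ua Vb]; exists (UV.1, UV.2) => //=.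
  by split; apply: open_nbhs_nbhs; split => //; [exact: oB1|exact: oB2].
have [U [BU Ux] UA] := bB1 _ _ Ax.
have [V [BV Vy] VB] := bB2 _ _ By.
exists (U `*` V) => [|z [Uz Vz]]; first by split => //; exists (U, V).
by apply: ABW; split; [exact: UA|exact: VB].
Qed.

End rectangles.

(** The maps [f1] and [f2] are meant to be identities: they let each factor
    carry, on one set of points, a sigma-algebra and a topology that are not
    bundled together. *)
Lemma continuous_measurable_prod d1 d2 (T1 : measurableType d1)
    (T2 : measurableType d2) (S1 S2 : topologicalType) (R : realType)
    (f1 : T1 -> S1) (f2 : T2 -> S2) (g : S1 * S2 -> R) :
  @second_countable S1 -> @second_countable S2 ->
  (forall U, open U -> measurable (f1 @^-1` U)) ->
  (forall U, open U -> measurable (f2 @^-1` U)) ->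
  continuous g -> measurable_fun setT (fun z : T1 * T2 => g (f1 z.1, f2 z.2)).
Proof.
move=> sc1 sc2 m1 m2 /continuousP cg.
apply: (measurability _ (RGenOpens.measurableE R)) => _ [_ [a [b -> <-]]].
rewrite setTI.
have [A [B [oA oB AB]]] := open_bigcup_rectangles sc1 sc2
  (cg _ (@interval_open _ (BRight a) (BLeft b) isT isT)).
rewrite (_ : _ @^-1` _ = \bigcup_i ((f1 @^-1` A i) `*` (f2 @^-1` B i))).
  by apply: bigcupT_measurable => i; apply: measurableX; [exact: m1|exact: m2].
apply/seteqP; split=> [z|z [i _ [Az Bz]]].
- move=> zab; have : (g @^-1` `]a, b[%classic) (f1 z.1, f2 z.2) by [].
  by rewrite AB => -[i _ [Az Bz]]; exists i.
- have : (\bigcup_i (A i `*` B i)) (f1 z.1, f2 z.2) by exists i.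
  by rewrite -AB.
Qed.

Lemma borel_open (X : ptopologicalType) (U : set X) : open U ->
  @measurable _ (borel X) U.
Proof. exact: sub_sigma_algebra. Qed.

Section couplings_null_open.
Context (R : realType) (X Y : ptopologicalType).
Hypotheses (pX : polish R X) (pY : polish R Y).
Variables (mu : probability (borel X) R) (nu : probability (borel Y) R).

(** In a null open rectangle one side is null for its marginal, and any
    coupling gives the rectangle at most the mass of that side.  This fails for
    null sets that are not open, such as the diagonal of the unit square. *)
Lemma coupling_null_open pi (W : set (X * Y)) : coupling mu nu pi ->
  open W -> (indep mu nu).-negligible W -> pi.-negligible W.
Proof.
move=> [pi1 pi2] oW [N [mN N0 WN]].
have [A [B [oA oB AB]]] := open_bigcup_rectangles
  (polish_second_countable pX) (polish_second_countable pY) oW.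
rewrite AB; apply: negligible_bigcup => i.
have mA : @measurable _ (borel X) (A i) by exact: borel_open.
have mB : @measurable _ (borel Y) (B i) by exact: borel_open.
have mAB : @measurable _ (borel X * borel Y)%type (A i `*` B i).
  exact: measurableX.
apply/negligibleP => //; apply/eqP; rewrite -measure_le0.
have : (mu (A i) * nu (B i) = 0)%E.
  rewrite -(product_measure1E mu nu mA mB); apply/eqP; rewrite -measure_le0 -N0.
  apply: le_measure; rewrite ?inE//.
  by apply: subset_trans WN; rewrite AB => z zi; exists i.
move/eqP; rewrite mule_eq0 => /orP[] /eqP <-.
- rewrite -pi1//; apply: le_measure; rewrite ?inE//.
    by rewrite -[X in measurable X]setTI; exact: measurable_fst.
  by move=> z [].
- rewrite -pi2//; apply: le_measure; rewrite ?inE//.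
    by rewrite -[X in measurable X]setTI; exact: measurable_snd.
  by move=> z [].
Qed.

End couplings_null_open.

Section pd_potential.
Context (R : realType) (S : topologicalType) (k : S -> S -> R) (C : R).
Hypotheses (kpd : pos_def_kernel k) (kC : forall p q, `|k p q| <= C).

Let gap p p' := k p p - 2 * k p p' + k p' p'.

(** The Cauchy-Schwarz inequality of the kernel, in the additive form obtained
    from the three points [p], [p'], [q] with weights [1], [-1], [e] or [-e];
    it bounds the increment of [k] uniformly in [q]. *)
Lemma pd_kernel_increment p p' q (e : R) : 0 < e ->
  `|k p q - k p' q| <= 2^-1 * (gap p p' / e + e * C).
Proof.
move=> e0; rewrite ler_pdivlMl//.
have H (s : R) : 0 <= gap p p' + 2 * s * (k p q - k p' q) + s ^+ 2 * k q q.
  have := pos_def_kernel_seq kpd [:: (1, p); (-1, p'); (s, q)].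
  rewrite !big_cons !big_nil/= (kpd.1 p' p) (kpd.1 q p) (kpd.1 q p').
  by congr (_ <= _); rewrite /gap; ring.
have kqC : k q q <= C by rewrite (le_trans (ler_norm _)).
rewrite -(ler_pM2l e0) mulrDr (mulrC e (_ / e)) divfK ?gt_eqF//.
have He := H e; have HNe := H (- e).
have : e ^+ 2 * k q q <= e * (e * C).
  by rewrite expr2 -mulrA !ler_pM2l.
by case: ger0P => _; lra.
Qed.

Lemma pd_gap_continuous p : continuous (fun z : S * S => k z.1 z.2) ->
  gap p p' @[p' --> p] --> 0.
Proof.
move=> kcont.
have c1 : k p p' @[p' --> p] --> k p p.
  apply: (continuous2_cvg _ (h := k)); first exact: (kcont (p, p)).
  - exact: cvg_cst.
  - exact: cvg_id.
have c2 : k p' p' @[p' --> p] --> k p p.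
  by apply: (continuous2_cvg _ (h := k)); [exact: (kcont (p, p))|exact: cvg_id..].
rewrite (_ : 0 = k p p - 2 * k p p + k p p); last by ring.
apply: cvgD => //; apply: cvgB; first exact: cvg_cst.
by apply: cvgM => //; exact: cvg_cst.
Qed.

End pd_potential.

(** The increment of [k] between [p] and [p'] is small uniformly in the other
    argument, so it stays small after integration. *)
Lemma pd_potential_continuous d (T : measurableType d) (R : realType)
    (P : probability T R) (S : topologicalType) (f : T -> S) (k : S -> S -> R)
    (C : R) : pos_def_kernel k -> (forall p q, `|k p q| <= C) ->
  continuous (fun z : S * S => k z.1 z.2) ->
  (forall p, L1 P (fun q => k p (f q))) ->
  continuous (fun p => \int[P]_q k p (f q)).
Proof.
move=> kpd kC kcont kL1 p; apply/cvgrPdist_lt => e e0.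
have C0 : 0 <= C by exact: le_trans (kC p p).
have C1 : 0 < C + 1 by lra.
(* Balances the two terms of the bound: both are then below [e]. *)
pose r := e / (C + 1).
have r0 : 0 < r by rewrite divr_gt0.
have rC : r * C < e by rewrite /r mulrAC ltr_pdivrMr// ltr_pM2l// ltrDl.
have /cvgr_dist_lt /(_ (e * r) (mulr_gt0 e0 r0)) := pd_gap_continuous p kcont.
apply: filterS => p'; rewrite sub0r normrN => gap_small.
rewrite -RintB//.
apply: (@le_lt_trans _ _ (2^-1 * ((k p p - 2 * k p p' + k p' p') / r + r * C))).
  apply: Rint_bound => [|q]; first exact: L1B.
  exact: pd_kernel_increment.
have : (k p p - 2 * k p p' + k p' p') / r < e.
  by rewrite ltr_pdivrMr// (le_lt_trans (ler_norm _)).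
lra.
Qed.

Section coupling_invariance.
Context (R : realType) (X Y : ptopologicalType).
Hypotheses (pX : polish R X) (pY : polish R Y).
Variables (mu : probability (borel X) R) (nu : probability (borel Y) R).

Lemma indep_coupling : coupling mu nu (indep mu nu).
Proof. exact: product_has_marginals. Qed.

(** A function of the form [phi + psi] is determined by its values on a cross
    through one point [(x0, y0)]: written in this way, the identity involves
    continuous functions only, even if [phi] and [psi] are not measurable, and
    so it passes from the product measure to every coupling. *)
Lemma ae_split_every_coupling (w : X * Y -> R) (phi : X -> R) (psi : Y -> R) :
  continuous w -> {ae indep mu nu, forall z, w z = phi z.1 + psi z.2} ->
  exists x0 y0, forall pi, coupling mu nu pi ->
    {ae pi, forall z, w z = w (z.1, y0) + w (x0, z.2) - w (x0, y0)}.
Proof.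
move=> wcont w_split.
have [sec1 sec2] := ae_section w_split.
have [x0 Fx0] := ae_exists sec1.
have [y0 [/= Fx0y0 Fy0]] := ae_exists (filterI Fx0 sec2).
exists x0, y0 => pi pi_coupling.
(* The set where the identity fails is open. *)
pose r (z : X * Y) := w z - (w (z.1, y0) + w (x0, z.2) - w (x0, y0)).
have rcont : continuous r.
  move=> z; apply: cvgB; first exact: wcont.
  apply: cvgB; last exact: cvg_cst.
  apply: cvgD.
  - apply: (cvg_comp (fun z : X * Y => (z.1, y0)) w); last exact: wcont.
    by apply: cvg_pair; [exact: cvg_fst|exact: cvg_cst].
  - apply: (cvg_comp (fun z : X * Y => (x0, z.2)) w); last exact: wcont.
    by apply: cvg_pair; [exact: cvg_cst|exact: cvg_snd].
have r_open : open (r @^-1` [set t | t != 0]).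
  by move/continuousP : rcont; apply; exact: open_neq.
have r_ae0 : {ae indep mu nu, forall z, r z = 0}.
  have F1 := ae_image (P := indep mu nu) measurable_fst indep_coupling.1 Fy0.
  have F2 := ae_image (P := indep mu nu) measurable_snd indep_coupling.2 Fx0.
  apply: filterS (filterI (filterI F1 F2) w_split) => z [[/= e1 e2] e3].
  by rewrite /r e1 e2 e3 /= Fx0y0 /=; ring.
have : pi.-negligible (r @^-1` [set t | t != 0]).
  apply: (coupling_null_open pX pY pi_coupling r_open).
  by apply: negligibleS r_ae0 => z /= /eqP.
apply: negligibleS => z /= rz; apply/eqP => /eqP.
by rewrite /r subr_eq0 => /eqP.
Qed.

Lemma Rint_coupling_invariant (w : X * Y -> R) (C : R) pi :
  @measurable_fun _ _ (borel X * borel Y)%type R setT w ->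
  (forall z, `|w z| <= C) -> continuous w ->
  (exists (phi : X -> R) (psi : Y -> R),
    {ae indep mu nu, forall z, w z = phi z.1 + psi z.2}) ->
  coupling mu nu pi -> \int[pi]_z w z = \int[indep mu nu]_z w z.
Proof.
move=> mw wC wcont [phi [psi w_split]] pi_coupling.
have [x0 [y0 w_ae]] := ae_split_every_coupling wcont w_split.
have wx : L1 mu (fun x => w (x, y0)) by exact: (L1_bounded_kernell mu mw wC).
have wy : L1 nu (fun y => w (x0, y)) by exact: (L1_bounded_kernelr nu mw wC).
have key D : coupling mu nu D -> \int[D]_z w z =
    \int[mu]_x w (x, y0) + \int[nu]_y w (x0, y) - w (x0, y0).
  move=> [D1 D2].
  have i1 := L1_image measurable_fst D1 wx.
  have i2 := L1_image measurable_snd D2 wy.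
  have i12 : L1 D (fun z => w (z.1, y0) + w (x0, z.2)) by exact: L1D i1 i2.
  have i3 : L1 D (fun z => w (z.1, y0) + w (x0, z.2) - w (x0, y0)).
    by apply: L1B => //; exact: L1_cst.
  rewrite (Rint_ae_eq _ (L1_measurable i3) (w_ae D (conj D1 D2))); last first.
    exact: (L1_bounded C).
  rewrite RintB//; last exact: L1_cst.
  rewrite (RintD i1 i2) Rint_cst.
  by rewrite (Rint_image measurable_fst D1 wx) (Rint_image measurable_snd D2 wy).
by rewrite key// key//; exact: indep_coupling.
Qed.

End coupling_invariance.

(** * The quadratic cost over couplings *)

Section quadratic_cost.
Context (R : realType) (X Y : ptopologicalType).
Hypotheses (pX : polish R X) (pY : polish R Y).
Variables (mu : probability (borel X) R) (nu : probability (borel Y) R).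
Let T : measurableType _ := (borel X * borel Y)%type.

Lemma continuous_measurable_kernel (k : (X * Y) * (X * Y) -> R) :
  continuous k ->
  @measurable_fun _ _ (T * T)%type R setT k.
Proof.
move=> kcont.
rewrite (_ : k = (fun z : T * T => k (id z.1, id z.2))); last first.
  by apply/funext => -[].
have sc : @second_countable (X * Y)%type.
  by apply: second_countable_prod; exact: (polish_second_countable (R := R)).
have mopen (U : set (X * Y)) : open U -> @measurable _ T (id @^-1` U).
  by move=> oU; rewrite (borel_prodE pX pY); exact: sub_sigma_algebra.
exact: (continuous_measurable_prod sc sc mopen mopen kcont).
Qed.

Variables (c : (X * Y) * (X * Y) -> R) (cX : X -> R) (cY : Y -> R).
Hypotheses (c_cont : continuous c) (IcX : L1 mu cX) (IcY : L1 nu cY).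
Hypothesis c_bound : forall x y x' y',
  `|c ((x, y), (x', y'))| <= cX x + cY y + cX x' + cY y'.

Let mc : @measurable_fun _ _ (T * T)%type R setT c.
Proof. exact: continuous_measurable_kernel. Qed.

Let cb (p q : T) : `|c (p, q)| <= (cX p.1 + cY p.2) + (cX q.1 + cY q.2).
Proof. by case: p q => [x y] [x' y']; rewrite addrA; exact: c_bound. Qed.

Let Ib pi : coupling mu nu pi -> L1 pi (fun z : T => cX z.1 + cY z.2).
Proof. exact: L1_marginals. Qed.

Let Iind := Ib (indep_coupling mu nu).

Lemma qcostE pi : coupling mu nu pi ->
  qcost c pi = (\int[pi]_p \int[pi]_q c (p, q))%:E.
Proof.
move=> /Ib Ipi; have Ic := L1_dominated_kernel mc cb Ipi Ipi.
rewrite /qcost (RintegralE Ic) (Rint_fubini1 Ic)// => p.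
exact: (L1_dominated_kernelr mc cb Ipi).
Qed.

Let w (p : X * Y) : R :=
  2^-1 * (\int[indep mu nu]_q c (p, q) + \int[indep mu nu]_q c (q, p)).

Let cr (p : T) : L1 (indep mu nu) (fun q : T => c (p, q)).
Proof. exact: (L1_dominated_kernelr mc cb Iind). Qed.

Let cl (q : T) : L1 (indep mu nu) (fun p : T => c (p, q)).
Proof. exact: (L1_dominated_kernell mc cb Iind). Qed.

Lemma ctildeE p : ctilde c mu nu p = (w p)%:E.
Proof.
rewrite /ctilde /w -RintD; [|exact: cr|exact: cl].
rewrite EFinM; congr (_ * _)%E.
by rewrite -(RintegralE (L1D (cr p) (cl p))).
Qed.

Let Iw : L1 (indep mu nu) w.
Proof.
apply: L1Zl; apply: L1D.
- exact: L1_dominated_potentialr mc cb Iind Iind.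
- exact: L1_dominated_potentiall mc cb Iind Iind.
Qed.

Let bnd := \int[indep mu nu]_q (cX q.1 + cY q.2).

Let w_bound (p : T) : `|w p| <= (cX p.1 + cY p.2) + bnd.
Proof.
have half (f : T -> R) : L1 (indep mu nu) f ->
    (forall q : T, `|f q| <= (cX p.1 + cY p.2) + (cX q.1 + cY q.2)) ->
    `|\int[indep mu nu]_q f q| <= (cX p.1 + cY p.2) + bnd.
  move=> If fb; rewrite (le_trans (le_normr_Rintegral _ _))//.
  rewrite -[X in X + bnd](@Rint_cst _ _ _ (indep mu nu)) /bnd -RintD;
    [|exact: L1_cst|exact: Iind].
  apply: le_Rintegral => //; first exact: integrable_norm If.
  by apply: L1D; [exact: L1_cst|exact: Iind].
rewrite /w normrM ger0_norm ?invr_ge0// ler_pdivrMl//.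
rewrite (le_trans (ler_normD _ _))//.
rewrite mulr_natl mulr2n lerD//; apply: half => [|q].
- exact: cr.
- exact: cb.
- exact: cl.
- by rewrite addrC; exact: cb.
Qed.

(** The cost of every coupling is finite, so extremality in the extended reals
    is extremality of the real double integrals. *)
Lemma extremal_split :
  minimizer (coupling mu nu) (qcost c) (indep mu nu) \/
  maximizer (coupling mu nu) (qcost c) (indep mu nu) ->
  exists (phi : X -> R) (psi : Y -> R),
    {ae indep mu nu, forall p, ctilde c mu nu p = (phi p.1 + psi p.2)%:E}.
Proof.
move=> extr.
have [e e0 le_cost] : exists2 e : R, e != 0 & forall pi, coupling mu nu pi ->
    e * \int[indep mu nu]_p \int[indep mu nu]_q c (p, q) <=
    e * \int[pi]_p \int[pi]_q c (p, q).
  case: extr => -[_ opt].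
  - exists 1; first exact: oner_neq0.
    move=> pi pic; have := opt _ pic.
    rewrite !qcostE//; last exact: indep_coupling.
    by rewrite lee_fin !mul1r.
  - exists (-1); first by rewrite oppr_eq0 oner_neq0.
    move=> pi pic; have := opt _ pic.
    rewrite !qcostE//; last exact: indep_coupling.
    by rewrite lee_fin !mulN1r lerN2.
have ann := extremal_product_annihilator IcX IcY mc cb e0 le_cost.
have mw := L1_measurable Iw.
have [|||phi [psi w_split]] := ae_split_of_annihilator Iw.
- move=> x; apply: (L1_dominated (g := fun y : borel Y => (cX x + cY y) + bnd)).
  + by apply: (measurableT_comp mw); exact: pair1_measurable.
  + by move=> y; exact: (w_bound (x, y)).
  + by apply: L1D; [apply: L1D => //|]; exact: L1_cst.
- move=> y; apply: (L1_dominated (g := fun x : borel X => (cX x + cY y) + bnd)).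
  + by apply: (measurableT_comp mw); exact: pair2_measurable.
  + by move=> x; exact: (w_bound (x, y)).
  + by apply: L1D; [apply: L1D => //|]; exact: L1_cst.
- move=> h mh h1 h0; have h_ann := ann h mh h1 h0.
  rewrite (eq_Rintegral _ (g := fun z => 2^-1 * (h z *
    (\int[indep mu nu]_q c (z, q) + \int[indep mu nu]_q c (q, z)))));
    last first.
    by move=> z _; rewrite /w mulrCA.
  rewrite RintZ; first by rewrite [X in _ * X]h_ann mulr0.
  apply: (L1M (C := 1) _ mh) => //; apply: L1D.
  + exact: L1_dominated_potentialr mc cb Iind Iind.
  + exact: L1_dominated_potentiall mc cb Iind Iind.
exists phi, psi; apply: filterS w_split => z wz.
by rewrite ctildeE wz.
Qed.

Section positive_definite.
Variables (k : X * Y -> X * Y -> R) (C : R).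
Hypotheses (kC : forall p q, `|k p q| <= C) (kpd : pos_def_kernel k).
Hypothesis k_cont : continuous (fun z : (X * Y) * (X * Y) => k z.1 z.2).
Hypothesis ck : forall x y x' y', c ((x, y), (x', y')) = k (x, y) (x', y').

(** With the integral of [w] independent of the coupling, the difference of the
    costs is exactly the energy distance between the coupling and the product
    measure. *)
Lemma split_minimizer :
  (exists (phi : X -> R) (psi : Y -> R),
    {ae indep mu nu, forall p, ctilde c mu nu p = (phi p.1 + psi p.2)%:E}) ->
  minimizer (coupling mu nu) (qcost c) (indep mu nu).
Proof.
move=> [phi [psi split_ae]]; split; first exact: indep_coupling.
move=> pi pi_coupling; rewrite !qcostE//; last exact: indep_coupling.
have ckE p q : c (p, q) = k p q by case: p q => [x y] [x' y'].
have wE p : w p = \int[indep mu nu]_q k p q.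
  have e1 : \int[indep mu nu]_q c (p, q) = \int[indep mu nu]_q k p q.
    by apply: eq_Rintegral => q _; rewrite ckE.
  have e2 : \int[indep mu nu]_q c ((q : T), p) = \int[indep mu nu]_q k p q.
    by apply: eq_Rintegral => q _; rewrite ckE kpd.1.
  by rewrite /w e1 e2; field.
have mk : @measurable_fun _ _ (T * T)%type R setT (fun z => k z.1 z.2).
  exact: (continuous_measurable_kernel k_cont).
have kC' (z : T * T) : `|(fun z : T * T => k z.1 z.2) z| <= C by exact: kC.
have w_cont : continuous w.
  rewrite (_ : w = fun p => \int[indep mu nu]_q k p (id q)); last exact/funext.
  apply: (pd_potential_continuous (P := indep mu nu) kpd kC k_cont) => p.
  exact: (L1_bounded_kernelr (indep mu nu) mk kC').
have wC p : `|w p| <= C.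
  rewrite wE; apply: Rint_bound => //.
  exact: (L1_bounded_kernelr (indep mu nu) mk kC').
have w_inv : \int[pi]_p w p = \int[indep mu nu]_p w p.
  apply: (Rint_coupling_invariant pX pY (L1_measurable Iw) wC w_cont) pi_coupling.
  exists phi, psi; apply: negligibleS split_ae => z.
  by apply: contra_not; rewrite /= ctildeE => -[].
have := energy_distance_ge0 pi (indep mu nu) mk kC kpd.
have -> : \int[pi]_p \int[indep mu nu]_q k p q = \int[indep mu nu]_p w p.
  by rewrite -w_inv; apply: eq_Rintegral => p _; rewrite wE.
have -> : \int[indep mu nu]_p \int[pi]_q k p q = \int[indep mu nu]_p w p.
  have Ik := L1_bounded_kernel (indep mu nu) pi mk kC'.
  rewrite -(Rint_fubini1 Ik (L1_bounded_kernelr pi mk kC')).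
  rewrite (Rint_fubini2 Ik (L1_bounded_kernell (indep mu nu) mk kC')) -w_inv.
  apply: eq_Rintegral => p _; rewrite wE.
  by apply: eq_Rintegral => q _; rewrite /= kpd.1.
have -> : \int[indep mu nu]_p \int[indep mu nu]_q k p q =
    \int[indep mu nu]_p w p.
  by apply: eq_Rintegral => p _; rewrite wE.
rewrite lee_fin.
have -> : \int[indep mu nu]_p \int[indep mu nu]_q c (p, q) =
    \int[indep mu nu]_p w p.
  apply: eq_Rintegral => p _; rewrite wE.
  by apply: eq_Rintegral => q _; rewrite ckE.
have -> : \int[pi]_p \int[pi]_q c (p, q) = \int[pi]_p \int[pi]_q k p q.
  by apply: eq_Rintegral => p _; apply: eq_Rintegral => q _; rewrite ckE.
lra.
Qed.

End positive_definite.
End quadratic_cost.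

Theorem proposition15
  (R : realType) (X Y : ptopologicalType)
  (polishX : polish R X) (polishY : polish R Y)
  (mu : probability (borel X) R) (nu : probability (borel Y) R)
  (c : (X * Y) * (X * Y) -> R) (c_cont : continuous c)
  (cX : X -> R) (cY : Y -> R)
  (cX_cont : continuous cX) (cY_cont : continuous cY)
  (cX_L1 : mu.-integrable setT (fun x => (cX x)%:E))
  (cY_L1 : nu.-integrable setT (fun y => (cY y)%:E))
  (c_bound : forall x y x' y',
     `|c ((x, y), (x', y'))| <= cX x + cY y + cX x' + cY y') :
  let Pi := coupling mu nu in
  let cost := qcost c in
  let pi_ind := indep mu nu in
  let stmt_i := forall pi, Pi pi -> minimizer Pi cost pi in
  let stmt_ii := minimizer Pi cost pi_ind \/ maximizer Pi cost pi_ind in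
  let stmt_iii := exists (phi : X -> R) (psi : Y -> R),
    {ae pi_ind, forall p, ctilde c mu nu p = (phi p.1 + psi p.2)%:E} in
  [/\ stmt_i -> stmt_ii,
      stmt_ii -> stmt_iii
    & forall k : X * Y -> X * Y -> R,
        (exists C : R, forall p q, `|k p q| <= C) ->
        continuous (fun z : (X * Y) * (X * Y) => k z.1 z.2) ->
        pos_def_kernel k ->
        (forall x y x' y', c ((x, y), (x', y')) = k (x, y) (x', y')) ->
        (stmt_iii -> minimizer Pi cost pi_ind) /\ (stmt_ii <-> stmt_iii)].
Proof.
move=> Pi cost pi_ind stmt_i stmt_ii stmt_iii.
have ii_iii : stmt_ii -> stmt_iii.
  exact: (extremal_split polishX polishY c_cont cX_L1 cY_L1 c_bound).
split=> [all_min|//|k [C kC] k_cont kpd ck].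
  by left; apply: all_min; exact: indep_coupling.
have iii_min : stmt_iii -> minimizer Pi cost pi_ind.
  exact: (split_minimizer polishX polishY c_cont cX_L1 cY_L1 c_bound
            kC kpd k_cont ck).
by split=> //; split=> // /iii_min; left.
Qed.
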